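(* Let $\mathcal{Z}$ be an arc diagram, and let $\mathcal{B}=\mathcal{B}(\mathcal{Z})$ and $\mathcal{C}=\mathcal{C}(\mathcal{Z})$. Then the derived categories $\mathcal{D}^b({}_{\mathcal{B}}\mathsf{Mod})$ and $\mathcal{D}^b({}_{\mathcal{C}}\mathsf{Mod})$ are finitely generated.
   Context: **Arc diagrams.** An arc diagram $\mathcal{Z}=(Z,M,\mathbf{z})$ consists of oriented circles $Z=(Z_1,\dots,Z_b)$, $b>0$, a basepoint $z_i\in Z_i$ for each $i$, a set $\mathbf{a}\subset Z\setminus\mathbf{z}$ of $2n$ points, and a partition $M$ of $\mathbf{a}$ into $n$ matched pairs $\{a_i,a_i'\}$, such that surgery on $Z$ along the pairs in $M$ gives a collection of circles each containing exactly one basepoint. The surface obtained by attaching a strip to $\{1\}\times Z\subset[0,1]\times Z$ at each pair of $M$ is assumed connected. **The algebra $\mathcal{B}(\mathcal{Z})$.** It has $\mathbb{F}_2$-basis: one element $I_i$ for each matched pair $\{a_i,a_i'\}$, and one element $\rho$ (a chord) for each nontrivial interval in some $Z_i\setminus\{z_i\}$ with endpoints in $\mathbf{a}$; $\rho^-,\rho^+$ are its initial and terminal points. Products: the $I_i$ are orthogonal idempotents; $I_i\rho=\rho$ if $\rho^-\in\{a_i,a_i'\}$ and $0$ otherwise; $\rho I_j=\rho$ if $\rho^+\in\{a_j,a_j'\}$ and $0$ otherwise; $\rho\sigma$ is the chord from $\rho^-$ to $\sigma^+$ if $\rho^+=\sigma^-$ and $0$ otherwise. The differential is zero. **The algebra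 $\mathcal{C}(\mathcal{Z})$.** A strand diagram is a map $s\colon\coprod_{i=1}^k[0,1]\to[0,1]\times(Z\setminus\mathbf{z})$ (up to reordering components, called strands), linear of non-negative slope on each component, sending initial (terminal) endpoints injectively to $\{0\}\times\mathbf{a}$ (to $\{1\}\times\mathbf{a}$), such that for each matched pair $\{a,a'\}$: a slope-zero strand starts at $a$ iff one starts at $a'$; if a positive-slope strand starts (ends) at one of $a,a'$ then no strand starts (ends) at the other. $\mathcal{A}(\mathcal{Z})$ is the $\mathbb{F}_2$-span of strand diagrams. The product $s\cdot t$ is $0$ if: a positive-slope strand of $s$ (of $t$) ends (starts) at a point which is not the start (end) of a strand of $t$ (of $s$); or there is a pair of slope-zero strands (at a matched pair) in $s$ (in $t$) neither of which meets a strand of $t$ (of $s$); or the concatenation contains two piecewise-linear paths intersecting twice. Otherwise $s\cdot t$ is obtained by concatenating, deleting the unmatched horizontal strands, and pulling straight. The differential $\partial s$ is the sum over pairs of intersecting strands of the resolution of their crossing (pulled straight), where a resolution creating a double crossing between some pair of strands counts as $0$, and if a resolved strand was horizontal at a point $a$, the horizontal strand at the matched point $a'$ is deleted. The weight of $s$ is the number of positive-slope strands plus half the number of slope-zero strands. $\mathcal{C}(\mathcal{Z})$ is the differential subalgebra spanned by strand diagrams of weight $n-1$. **Categories.** For a finite-dimensional differential algebra $A$ over $\mathbb{F}_2$, $\mathcal{D}^b({}_A\mathsf{Mod})$ is the derived category of finitely generated (ungraded) differential left $A$-modules; it is an ungraded analogue of a triangulated category. Given objects $\{M_i\}$ in a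 triangulated category $\mathscr{C}$, the subcategory generated by $\{M_i\}$ is the smallest triangulated subcategory of $\mathscr{C}$ containing all $M_i$; $\{M_i\}$ generate $\mathscr{C}$ if this subcategory is $\mathscr{C}$. $\mathscr{C}$ is finitely generated if some finite set of objects generates it. *)

(* Defs.v *)
From HB Require Import structures.
From mathcomp Require Import all_boot all_order all_algebra.

Set Implicit Arguments.
Unset Strict Implicit.
Unset Printing Implicit Defensive.

Import GRing.Theory.
Local Open Scope ring_scope.

(* Associativity, unitality, the Leibniz rule and dif \o dif = 0 are not
   recorded: the notion of a differential module below only refers to the
   operations.  All uses are the algebras B(Z) and C(Z), for which these laws
   hold. *)
Record dalg := DAlg {
  da_car :> vectType 'F_2;
  da_one : da_car;
  da_mul : da_car -> da_car -> da_car;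
  da_dif : da_car -> da_car }.

(* A differential algebra given on a basis by its structure constants:
   [sc_mul t u v] is the coefficient of v in the product t u, and [sc_dif t v]
   is the coefficient of v in the differential of t. *)
Record struct_const (T : finType) := StructConst {
  sc_one : T -> 'F_2;
  sc_mul : T -> T -> T -> 'F_2;
  sc_dif : T -> T -> 'F_2 }.

Definition dalg_of (T : finType) (c : struct_const T) : dalg :=
  {| da_car := {ffun T -> ('F_2)^o};
     da_one := [ffun v => sc_one c v];
     da_mul := fun x y =>
       [ffun v => \sum_t \sum_u (x t : 'F_2) * (y u : 'F_2) * sc_mul c t u v];
     da_dif := fun x => [ffun v => \sum_t (x t : 'F_2) * sc_dif c t v] |}.

Definition sc_restrict (T : finType) (P : pred T) (c : struct_const T) :
    struct_const {t : T | P t} :=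
  {| sc_one := fun v => sc_one c (val v);
     sc_mul := fun t u v => sc_mul c (val t) (val u) (val v);
     sc_dif := fun t v => sc_dif c (val t) (val v) |}.

Record dmod (A : dalg) := DMod {
  dm_car :> lmodType 'F_2;
  dm_act : A -> dm_car -> dm_car;
  dm_dif : {linear dm_car -> dm_car};
  dm_act_linr : forall a, linear (dm_act a);
  dm_act_linl : forall m, linear (dm_act^~ m);
  dm_act1 : forall m, dm_act (da_one A) m = m;
  dm_actA : forall a b m, dm_act (da_mul a b) m = dm_act a (dm_act b m);
  dm_difK : forall m, dm_dif (dm_dif m) = 0;
  dm_leibniz : forall a m,
    dm_dif (dm_act a m) = dm_act (da_dif a) m + dm_act a (dm_dif m);
  dm_fingen : exists (k : nat) (g : 'I_k -> dm_car), forall m,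
    exists c : 'I_k -> A, m = \sum_(i < k) dm_act (c i) (g i) }.

Arguments dm_act {A} _ _ _.
Arguments dm_dif {A} _.

Section Modules.
Variable A : dalg.
Implicit Types M N P X Y W : dmod A.

Record dhom M N := DHom {
  dh_fun :> {linear M -> N};
  dh_act : forall a m, dh_fun (dm_act M a m) = dm_act N a (dh_fun m);
  dh_dif : forall m, dh_fun (dm_dif M m) = dm_dif N (dh_fun m) }.

Definition dhom_id M : dhom M M :=
  @DHom M M idfun (fun _ _ => erefl) (fun _ => erefl).

Lemma dhom_comp_act M N P (g : dhom N P) (f : dhom M N) a m :
  (g \o f) (dm_act M a m) = dm_act P a ((g \o f) m).
Proof. by rewrite /= !dh_act. Qed.

Lemma dhom_comp_dif M N P (g : dhom N P) (f : dhom M N) m :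
  (g \o f) (dm_dif M m) = dm_dif P ((g \o f) m).
Proof. by rewrite /= !dh_dif. Qed.

Definition dhom_comp M N P (g : dhom N P) (f : dhom M N) : dhom M P :=
  @DHom M P (g \o f) (dhom_comp_act g f) (dhom_comp_dif g f).

(* No signs or shifts: the ground field has characteristic 2. *)
Definition homotopic M N (f g : dhom M N) : Prop :=
  exists2 h : {linear M -> N},
    forall a m, h (dm_act M a m) = dm_act N a (h m) &
    forall m, f m - g m = dm_dif N (h m) + h (dm_dif M m).

(* Bijectivity of the map induced on ker d / im d. *)
Definition quasi_iso M N (f : dhom M N) : Prop :=
  (forall x, dm_dif M x = 0 -> (exists z, f x = dm_dif N z) ->
     exists w, x = dm_dif M w) /\
  (forall y, dm_dif N y = 0 ->
     exists x z, dm_dif M x = 0 /\ y = f x + dm_dif N z).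

Section Cone.
Variables (M N : dmod A) (f : dhom M N).

Let car : lmodType 'F_2 := (N * M)%type.

Definition cone_act (a : A) (x : car) : car :=
  (dm_act N a x.1, dm_act M a x.2).

Definition cone_dif_fun (x : car) : car :=
  (dm_dif N x.1 + f x.2, dm_dif M x.2).

Fact cone_dif_linear : linear cone_dif_fun.
Proof.
move=> k x y; rewrite /cone_dif_fun; congr pair => /=; last by rewrite linearP.
by rewrite !linearP scalerDr addrACA.
Qed.

HB.instance Definition _ :=
  GRing.isLinear.Build 'F_2 car car *:%R cone_dif_fun cone_dif_linear.

Definition cone_dif : {linear car -> car} := cone_dif_fun.

Fact addF2 (V : lmodType 'F_2) (x : V) : x + x = 0.
Proof.
rewrite -[x]scale1r -scalerDl (_ : 1 + 1 = 0 :> 'F_2) ?scale0r //.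
exact/val_inj.
Qed.

Fact cone_act_linr a : linear (cone_act a).
Proof.
by move=> k x y; rewrite /cone_act /= !dm_act_linr.
Qed.

Fact cone_act_linl x : linear (cone_act^~ x).
Proof. by move=> k a b; rewrite /cone_act /= !dm_act_linl. Qed.

Fact cone_act1 x : cone_act (da_one A) x = x.
Proof. by case: x => n m; rewrite /cone_act !dm_act1. Qed.

Fact cone_actA a b x : cone_act (da_mul a b) x = cone_act a (cone_act b x).
Proof. by rewrite /cone_act /= !dm_actA. Qed.

Fact cone_difK x : cone_dif (cone_dif x) = 0.
Proof.
rewrite /cone_dif /= /cone_dif_fun /= linearD !dm_difK dh_dif add0r.
by rewrite addF2.
Qed.

Fact cone_leibniz a x :
  cone_dif (cone_act a x) = cone_act (da_dif a) x + cone_act a (cone_dif x).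
Proof.
have actD (P : dmod A) (u v : P) :
    dm_act P a (u + v) = dm_act P a u + dm_act P a v.
  by have := dm_act_linr (d := P) a 1 u v; rewrite !scale1r.
rewrite /cone_dif /= /cone_dif_fun /cone_act; congr pair => /=.
  by rewrite dm_leibniz dh_act actD addrA.
by rewrite dm_leibniz.
Qed.

Fact cone_fingen : exists (k : nat) (g : 'I_k -> car), forall x,
  exists c : 'I_k -> A, x = \sum_(i < k) cone_act (c i) (g i).
Proof.
have act0 (P : dmod A) a : dm_act P a 0 = 0.
  have := dm_act_linr (d := P) a 1 0 0; rewrite !scale1r addr0 => e.
  by apply/(addrI (dm_act P a 0)); rewrite addr0 -e.
have [k [g gP]] := dm_fingen N; have [l [h hP]] := dm_fingen M.
exists (k + l)%N, (fun i => match split i with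
  inl j => (g j, 0) | inr j => (0, h j) end) => -[n m].
have [c nE] := gP n; have [e mE] := hP m.
exists (fun i => match split i with inl j => c j | inr j => e j end).
rewrite big_split_ord /=.
under eq_bigr => i _ do rewrite -[lshift _ _]/(unsplit (inl i)) unsplitK.
under [X in _ + X]eq_bigr => i _ do
  rewrite -[rshift _ _]/(unsplit (inr i)) unsplitK.
have pairE (I : finType) (F : I -> car) :
    \sum_i F i = (\sum_i (F i).1, \sum_i (F i).2).
  by elim/big_rec3: _ => [|i x y z _ ->] //=; case: (F i).
rewrite !pairE /= -nE -mE.
rewrite [X in (_, X) + _]big1 ?[X in _ + (X, _)]big1 => [|i _|i _] //.
by congr pair; rewrite /= ?addr0 ?add0r.
Qed.

Definition cone : dmod A :=
  DMod cone_act_linr cone_act_linl cone_act1 cone_actA cone_difK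
    cone_leibniz cone_fingen.

Definition cone_inl_fun (n : N) : cone := (n, 0).

Fact cone_inl_linear : linear cone_inl_fun.
Proof.
by move=> k x y; congr pair; rewrite /= scaler0 addr0.
Qed.

HB.instance Definition _ :=
  GRing.isLinear.Build 'F_2 N cone *:%R cone_inl_fun cone_inl_linear.

Fact cone_inl_act a n : cone_inl_fun (dm_act N a n) = dm_act cone a (n, 0).
Proof.
congr pair; have := dm_act_linr (d := M) a 1 0 0; rewrite !scale1r addr0 => e.
by apply/(addrI (dm_act M a 0)); rewrite addr0 -e.
Qed.

Fact cone_inl_dif n : cone_inl_fun (dm_dif N n) = dm_dif cone (n, 0).
Proof. by congr pair; rewrite /= !linear0 ?addr0. Qed.

Definition cone_inl : dhom N cone := @DHom N cone cone_inl_fun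
  cone_inl_act cone_inl_dif.

Definition cone_proj_fun (x : cone) : M := x.2.

Fact cone_proj_linear : linear cone_proj_fun.
Proof. by []. Qed.

HB.instance Definition _ :=
  GRing.isLinear.Build 'F_2 cone M *:%R cone_proj_fun cone_proj_linear.

Definition cone_proj : dhom cone M := @DHom cone M cone_proj_fun
  (fun _ _ => erefl) (fun _ => erefl).

End Cone.

(* The localization at quasi-isomorphisms of the homotopy category, by
   generators and relations.  Morphisms are the terms of [dmor] up to
   [dmor_eq]. *)

Inductive dmor : dmod A -> dmod A -> Type :=
| dm_map X Y (f : dhom X Y) : dmor X Y
| dm_inv X Y (s : dhom X Y) (qs : quasi_iso s) : dmor Y X
| dm_comp X Y W (g : dmor Y W) (f : dmor X Y) : dmor X W.

Definition dm_id X : dmor X X := dm_map (dhom_id X).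

Inductive dmor_eq : forall X Y, dmor X Y -> dmor X Y -> Prop :=
| dme_refl X Y (f : dmor X Y) : dmor_eq f f
| dme_sym X Y (f g : dmor X Y) : dmor_eq f g -> dmor_eq g f
| dme_trans X Y (f g h : dmor X Y) :
    dmor_eq f g -> dmor_eq g h -> dmor_eq f h
| dme_congr X Y W (g g' : dmor Y W) (f f' : dmor X Y) :
    dmor_eq g g' -> dmor_eq f f' -> dmor_eq (dm_comp g f) (dm_comp g' f')
| dme_assoc X Y W V (h : dmor W V) (g : dmor Y W) (f : dmor X Y) :
    dmor_eq (dm_comp h (dm_comp g f)) (dm_comp (dm_comp h g) f)
| dme_idl X Y (f : dmor X Y) : dmor_eq (dm_comp (dm_id Y) f) f
| dme_idr X Y (f : dmor X Y) : dmor_eq (dm_comp f (dm_id X)) f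
| dme_map X Y W (g : dhom Y W) (f : dhom X Y) :
    dmor_eq (dm_map (dhom_comp g f)) (dm_comp (dm_map g) (dm_map f))
| dme_homotopic X Y (f g : dhom X Y) :
    homotopic f g -> dmor_eq (dm_map f) (dm_map g)
| dme_invl X Y (s : dhom X Y) (qs : quasi_iso s) :
    dmor_eq (dm_comp (dm_inv qs) (dm_map s)) (dm_id X)
| dme_invr X Y (s : dhom X Y) (qs : quasi_iso s) :
    dmor_eq (dm_comp (dm_map s) (dm_inv qs)) (dm_id Y).

Definition is_diso X Y (f : dmor X Y) : Prop :=
  exists g : dmor Y X,
    dmor_eq (dm_comp g f) (dm_id X) /\ dmor_eq (dm_comp f g) (dm_id Y).

(* Triangles X -> Y -> W -> X: the shift is the identity, as modules are
   ungraded and the characteristic is 2. *)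
Definition distinguished X Y W
    (u : dmor X Y) (v : dmor Y W) (w : dmor W X) : Prop :=
  exists (M N : dmod A) (f : dhom M N)
         (a : dmor X M) (b : dmor Y N) (c : dmor W (cone f)),
    [/\ is_diso a, is_diso b & is_diso c] /\
    [/\ dmor_eq (dm_comp b u) (dm_comp (dm_map f) a),
        dmor_eq (dm_comp c v) (dm_comp (dm_map (cone_inl f)) b) &
        dmor_eq (dm_comp a w) (dm_comp (dm_map (cone_proj f)) c)].

(* Strictly full triangulated subcategories, given by their objects. *)
Record triangulated_sub (S : dmod A -> Prop) : Prop := TriangulatedSub {
  ts_zero : forall X, (forall x : X, x = 0) -> S X;
  ts_iso : forall X Y (f : dmor X Y), is_diso f -> S X -> S Y;
  ts_tri12 : forall X Y W (u : dmor X Y) (v : dmor Y W) (w : dmor W X),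
    distinguished u v w -> S X -> S Y -> S W;
  ts_tri23 : forall X Y W (u : dmor X Y) (v : dmor Y W) (w : dmor W X),
    distinguished u v w -> S Y -> S W -> S X;
  ts_tri13 : forall X Y W (u : dmor X Y) (v : dmor Y W) (w : dmor W X),
    distinguished u v w -> S X -> S W -> S Y }.

Definition generated_sub (I : Type) (G : I -> dmod A) (X : dmod A) : Prop :=
  forall S, triangulated_sub S -> (forall i, S (G i)) -> S X.

Definition generate (I : Type) (G : I -> dmod A) : Prop :=
  forall X, generated_sub G X.

End Modules.

Definition Db_finitely_generated (A : dalg) : Prop :=
  exists (k : nat) (G : 'I_k -> dmod A), generate G.

Section Points.
(* [b] circles; the complement of the basepoint in the i-th circle is an
   oriented open interval, on which the [m i] points of a are numbered in
   increasing order. *)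
Variables (b : nat) (m : 'I_b -> nat).

Definition point : finType := {i : 'I_b & 'I_(m i)}.

Variable M : {set {set point}}.

Definition mate (a : point) : point :=
  odflt a [pick a' in pblock M a :\ a].

(* The points of a together with the basepoints. *)
Definition marked : finType := (point + 'I_b)%type.

Definition marked_at (i : 'I_b) (k : nat) : marked :=
  if insub k is Some p then inl (Tagged (fun i => 'I_(m i)) (p : 'I_(m i)))
  else inr i.

(* The next marked point along the oriented circle. *)
Definition next_marked (v : marked) : marked :=
  match v with
  | inl a => marked_at (tag a) (tagged a).+1
  | inr i => marked_at i 0%N
  end.

(* The components of the surgered 1-manifold are the orbits of this
   permutation, a marked point standing for the oriented arc that leaves it:
   surgery along {a, a'} joins the arc arriving at a to the arc leaving a', and
   the arc arriving at a' to the arc leaving a. *)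
Definition surgery_next (v : marked) : marked :=
  match next_marked v with
  | inl a => inl (mate a)
  | inr i => inr i
  end.

Definition strip_rel : rel 'I_b :=
  fun i j => [exists a : point, (tag a == i) && (tag (mate a) == j)].

End Points.

Record arc_diagram := ArcDiagram {
  ad_b : nat;
  ad_m : 'I_ad_b -> nat;
  ad_M : {set {set point ad_m}};
  ad_b_gt0 : (0 < ad_b)%N;
  ad_part : partition ad_M [set: point ad_m];
  ad_pair : {in ad_M, forall P : {set point ad_m}, #|P| = 2%N};
  ad_surgery : forall v : marked ad_m,
    exists! i : 'I_ad_b, fconnect (surgery_next ad_M) v (inr i);
  ad_connected : forall i j : 'I_ad_b, connect (strip_rel ad_M) i j }.

Section Algebras.
Variable Z : arc_diagram.

Definition pt : finType := point (@ad_m Z).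
Definition mt : pt -> pt := mate (ad_M Z).
Definition ad_n : nat := #|ad_M Z|.

(* a precedes a' on the same interval Z_i \ {z_i}. *)
Definition pt_lt (a a' : pt) : bool :=
  (tag a == tag a') && (tagged a < tagged a')%N.

Definition pair_idx : finType := {P : {set pt} | P \in ad_M Z}.
Definition chord : finType := {c : pt * pt | pt_lt c.1 c.2}.
Definition B_basis : finType := (pair_idx + chord)%type.

(* [B_mul t u v]: the product t u is nonzero and equal to v. *)
Definition B_mul (t u v : B_basis) : bool :=
  match t, u, v with
  | inl P, inl Q, inl R => (P == Q) && (R == P)
  | inl P, inr r, inr c => ((val r).1 \in val P) && (c == r)
  | inr r, inl P, inr c => ((val r).2 \in val P) && (c == r)
  | inr r, inr s, inr c =>
      ((val r).2 == (val s).1) && (val c == ((val r).1, (val s).2))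
  | _, _, _ => false
  end.

Definition B_sc : struct_const B_basis :=
  {| sc_one := fun t => (if t is inl _ then true else false)%:R;
     sc_mul := fun t u v => (B_mul t u v)%:R;
     sc_dif := fun _ _ => 0 |}.

Definition algB : dalg := dalg_of B_sc.

(* A strand is determined by its initial and terminal points, and a strand
   diagram by its set of strands. *)
Definition strand : finType := (pt * pt)%type.
Implicit Types (p q r : strand) (s t u : {set strand}).

Definition flat p : bool := p.1 == p.2.
Definition rising p : bool := pt_lt p.1 p.2.

Definition is_diagram s : bool :=
  [&& [forall p in s, flat p || rising p],
      [forall p in s, forall q in s,
         ((p.1 == q.1) || (p.2 == q.2)) ==> (p == q)],
      [forall a, ((a, a) \in s) == ((mt a, mt a) \in s)] &
      [forall p in s, rising p ==>
         [forall q in s, (q.1 != mt p.1) && (q.2 != mt p.2)]]].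

Definition diagram : finType := {s : {set strand} | is_diagram s}.
Definition strands (d : diagram) : {set strand} := val d.

(* The number of slope-zero strands is even. *)
Definition weight s : nat :=
  (#|[set p in s | rising p]| + #|[set p in s | flat p]|./2)%N.

Definition crossing p q : bool :=
  (pt_lt p.1 q.1 && pt_lt q.2 p.2) || (pt_lt q.1 p.1 && pt_lt p.2 q.2).

(* The conditions for the product of s and t not to vanish. *)
Definition composable s t : bool :=
  [&& [forall p in s, rising p ==> [exists q in t, q.1 == p.2]],
      [forall q in t, rising q ==> [exists p in s, p.2 == q.1]],
      [forall a, ((a, a) \in s) ==>
         [exists q in t, (q.1 == a) || (q.1 == mt a)]],
      [forall a, ((a, a) \in t) ==>
         [exists p in s, (p.2 == a) || (p.2 == mt a)]] &
      [forall p in s, forall p' in s, forall q in t, forall q' in t,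
         (p.2 == q.1) && (p'.2 == q'.1) ==>
         ~~ (crossing p p' && crossing q q')]].

Definition concat s t : {set strand} :=
  [set r | [exists p in s, exists q in t,
              (p.2 == q.1) && (r == (p.1, q.2))]].

(* The strands p, q of s cross, p starting below q, and resolving the crossing
   creates no double crossing.  The paths of the resolution follow p then q and
   q then p; one of them meets another strand r twice exactly if r starts
   between p and q and ends between them. *)
Definition resolvable s p q : bool :=
  [&& p \in s, q \in s, pt_lt p.1 q.1, pt_lt q.2 p.2 &
      ~~ [exists r in s, [&& pt_lt p.1 r.1, pt_lt r.1 q.1,
                             pt_lt q.2 r.2 & pt_lt r.2 p.2]]].

Definition flat_mate p : {set strand} :=
  if flat p then [set (mt p.1, mt p.1)] else set0.

Definition resolve s p q : {set strand} :=
  (s :\: ([set p; q] :|: flat_mate p :|: flat_mate q))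
    :|: [set (p.1, q.2); (q.1, p.2)].

(* The algebra A(Z); its unit is the sum of the diagrams all of whose strands
   have slope zero. *)
Definition A_sc : struct_const diagram :=
  {| sc_one := fun s : diagram => [forall p in strands s, flat p]%:R;
     sc_mul := fun s t u : diagram =>
       (composable (strands s) (strands t) && (strands u == concat (strands s) (strands t)))%:R;
     sc_dif := fun s u : diagram => \sum_(pq : strand * strand |
         resolvable (strands s) pq.1 pq.2)
       (strands u == resolve (strands s) pq.1 pq.2)%:R |}.

(* Stated with a successor so that n = 0 leaves no diagram. *)
Definition algC : dalg :=
  dalg_of (sc_restrict (fun s : diagram => (weight (strands s)).+1 == ad_n) A_sc).

End Algebras.

(* Main.v *)
From HB Require Import structures.
From mathcomp Require Import all_boot all_order all_algebra.
From mathcomp Require Import boolp.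
Require Import Defs.

(** Both algebras have a finite basis in which some elements, the E-part, are
    orthogonal idempotents with sum 1 (the I_i for B, the diagrams with only
    horizontal strands for C), while the remaining ones span a nilpotent ideal J
    that contains every differential: total length of chords or strands grows
    under left multiplication by J.  So A/J is a product of copies of the field
    with two elements, with zero differential, and each idempotent i gives a
    one-dimensional differential module S_i.  The finitely many S_i generate.

    Let M be a nonzero differential module.  Then dM + JM is a proper subspace.
    Otherwise d would be surjective on M/JM; as d squares to zero this forces
    M = JM, hence M = 0 by nilpotence.  Pick i and x with ix outside dM + JM, and
    a linear functional phi vanishing on dM + JM with phi(ix) = 1.  Then
    m |-> phi(im) is a surjective map of differential modules M -> S_i
    ([exists_map_to_simple]).  It is compatible with d although d need not
    commute with i, because the error (di)m lies in JM.

    For a surjection f : M -> N, the kernel of f is quasi-isomorphic to the cone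
    of f ([to_cone_quasi_iso]), so a triangulated subcategory containing N and
    the kernel contains M.  The kernel of M -> S_i has smaller dimension than M,
    and induction on the dimension concludes ([simples_generate_spanned]). *)

Set Implicit Arguments.
Unset Strict Implicit.
Unset Printing Implicit Defensive.

Import GRing.Theory.
Local Open Scope ring_scope.

(** * Finite-dimensional vector spaces over the field with two elements *)

Lemma F2_eq01 (k : 'F_2) : k = 0 \/ k = 1.
Proof. by case: k => [[|[|//]] lt_k2]; [left|right]; apply/val_inj. Qed.

Section Subspaces.
Variable V : lmodType 'F_2.
Implicit Type W : V -> Prop.

Definition subspace W := W 0 /\ forall x y, W x -> W y -> W (x + y).

Lemma subspace_sum W (I : finType) (P : pred I) (F : I -> V) :
  subspace W -> (forall i, P i -> W (F i)) -> W (\sum_(i | P i) F i).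
Proof. by case=> W0 WD WF; elim/big_ind: _. Qed.

Definition spans (I : finType) (P : {set I}) (g : I -> V) :=
  forall x, exists c : I -> 'F_2, x = \sum_(i in P) c i *: g i.

(** For each vector v of the list in turn, v is adjoined to the subspace unless
    this would bring x in, in which case v + x lies in it already. *)
Lemma enlarge_avoiding W x (s : seq V) : subspace W -> ~ W x ->
  exists W', [/\ subspace W', forall y, W y -> W' y, ~ W' x &
                 forall v, v \in s -> W' v \/ W' (v + x)].
Proof.
move=> subW xW; elim: s => [|v s [W' [[W'0 W'D] sWW' xW' sP]]].
  by exists W; split.
have [W'vx|nW'vx] := pselect (W' (v + x)).
  exists W'; split=> // u; rewrite inE => /orP[/eqP->|/sP//]; by right.
exists (fun y => W' y \/ W' (y + v)); split.
- split; first by left.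
  move=> y z [W'y|W'y] [W'z|W'z].
  + by left; apply: W'D.
  + by right; rewrite -addrA; apply: W'D.
  + by right; rewrite addrAC; apply: W'D.
  + by left; rewrite -[y + z]addr0 -(addF2 v) addrACA; apply: W'D.
- by move=> y /sWW'; left.
- by case=> //; rewrite addrC.
- move=> u; rewrite inE => /orP[/eqP->|/sP[]]; try by [left; left|right; left].
  by left; right; rewrite addF2.
Qed.

(** Once W is enlarged to meet {g i, g i + x} for every generator, it has index
    two with complement W + x, and membership in it is the functional. *)
Lemma separating_functional (I : finType) (P : {set I}) (g : I -> V) W x :
  spans P g -> subspace W -> ~ W x ->
  exists phi : {linear V -> ('F_2)^o},
    (forall y, W y -> phi y = 0) /\ phi x = 1.
Proof.
move=> spg subW xW.
have [W' [[W'0 W'D] sWW' xW' sP]] := enlarge_avoiding (map g (enum P)) subW xW.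
have dich y : W' y \/ W' (y + x).
  have [c ->] := spg y; elim/big_ind: _ => [|u v|i Pi]; first by left.
    case=> [Wu|Wu] [Wv|Wv].
    + by left; apply: W'D.
    + by right; rewrite -addrA; apply: W'D.
    + by right; rewrite addrAC; apply: W'D.
    + by left; rewrite -[u + v]addr0 -(addF2 x) addrACA; apply: W'D.
  have [->|->] := F2_eq01 (c i); first by left; rewrite scale0r.
  by rewrite scale1r; apply: sP; apply: map_f; rewrite mem_enum.
pose phi y : ('F_2)^o := if asbool (W' y) then 0 else 1.
have phi0 y : W' y -> phi y = 0 by rewrite /phi; case: asboolP.
have phi1 y : W' (y + x) -> phi y = 1.
  move=> Wyx; rewrite /phi; case: asboolP => // Wy; case: xW'.
  by rewrite -[x]add0r -(addF2 y) -addrA; apply: W'D.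
have phiD u v : phi (u + v) = phi u + phi v.
  have [Wu|Wu] := dich u; have [Wv|Wv] := dich v.
  - by rewrite !phi0 ?addr0 //; apply: W'D.
  - by rewrite (phi0 u) // !phi1 ?add0r // -addrA; apply: W'D.
  - by rewrite (phi0 v) // !phi1 ?addr0 // addrAC; apply: W'D.
  - rewrite (phi1 u) // (phi1 v) // addF2 phi0 //.
    by rewrite -[u + v]addr0 -(addF2 x) addrACA; apply: W'D.
have phi_lin : linear phi.
  move=> k u v; have [->|->] := F2_eq01 k.
    by rewrite !scale0r !add0r.
  by rewrite !scale1r phiD.
pose phiM := GRing.isLinear.Build 'F_2 V ('F_2)^o *:%R phi phi_lin.
pose phiL : {linear V -> ('F_2)^o} := HB.pack phi phiM.
exists phiL; split=> [y /sWW'/phi0 //|]; apply: phi1.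
by rewrite addF2.
Qed.

(** Gaussian elimination with pivot g i0: the kernel of phi is spanned by one
    vector fewer than the space. *)
Lemma spans_ker (I : finType) (P : {set I}) (g : I -> V)
    (phi : {linear V -> ('F_2)^o}) i0 x :
  spans P g -> phi (g i0) = 1 -> phi x = 0 -> exists c : I -> 'F_2,
    x = \sum_(i in P :\ i0) c i *: (g i - (phi (g i) : 'F_2) *: g i0).
Proof.
move=> spg phi_i0 phix0; have [c xE] := spg x; exists c.
(* The term of index i0 vanishes, so it may be put back into the sum. *)
have -> : \sum_(i in P :\ i0) c i *: (g i - (phi (g i) : 'F_2) *: g i0) =
          \sum_(i in P) c i *: (g i - (phi (g i) : 'F_2) *: g i0).
  have [Pi0|Pi0] := boolP (i0 \in P); last first.
    by apply: eq_bigl => i; rewrite !inE; case: eqP => // ->; rewrite (negbTE Pi0).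
  by rewrite [RHS](big_setD1 i0) //= phi_i0 scale1r subrr scaler0 add0r.
under eq_bigr do rewrite scalerBr scalerA.
rewrite big_split /= -xE sumrN -scaler_suml.
suff -> : \sum_(i in P) c i * (phi (g i) : 'F_2) = 0 by rewrite scale0r subr0.
by rewrite -[RHS]phix0 xE linear_sum; apply: eq_bigr => i _; rewrite linearZ.
Qed.

End Subspaces.

(** * Extensions in the derived category *)

Section DerivedCategory.
Variable A : dalg.
Implicit Types K M N X Y : dmod A.

HB.instance Definition _ M a :=
  GRing.isLinear.Build 'F_2 M M *:%R (dm_act M a) (dm_act_linr (d := M) a).

Definition act_on M (m : M) (a : A) : M := dm_act M a m.

HB.instance Definition _ M (m : M) :=
  GRing.isLinear.Build 'F_2 A M *:%R (act_on m) (dm_act_linl (d := M) m).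

(** Scalars act through multiples of the unit, so a finite spanning family over
    the field generates over the algebra.  The action is taken unbundled because
    the lemma serves to build modules. *)
Lemma spans_fingen (V : lmodType 'F_2) (act : A -> V -> V)
    (act_linl : forall m, linear (act^~ m))
    (act1 : forall m, act (da_one A) m = m)
    (I : finType) (P : {set I}) (g : I -> V) :
  spans P g -> exists (k : nat) (h : 'I_k -> V), forall m,
    exists c : 'I_k -> A, m = \sum_(i < k) act (c i) (h i).
Proof.
move=> spg; exists #|P|, (g \o enum_val) => m.
have [c {1}->] := spg m.
exists (fun i => c (enum_val i) *: da_one A).
rewrite big_enum_val; apply: eq_bigr => i _ /=.
have act0 : act 0 (g (enum_val i)) = 0.
  have := act_linl (g (enum_val i)) 1 0 0; rewrite /= scaler0 addr0 scale1r => e.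
  by apply/(addrI (act 0 (g (enum_val i)))); rewrite addr0 -e.
by have := act_linl (g (enum_val i)) (c (enum_val i)) (da_one A) 0;
   rewrite /= addr0 act0 addr0 act1 => ->.
Qed.

Section Kernel.
Variables (M N : dmod A) (f : dhom M N).

Definition in_ker : {pred M} := fun x => f x == 0.

Fact in_ker_submod : submod_closed in_ker.
Proof.
split; first by rewrite unfold_in linear0.
by move=> k x y; rewrite !unfold_in linearP => /eqP-> /eqP->; rewrite scaler0 addr0.
Qed.

HB.instance Definition _ := GRing.isSubmodClosed.Build 'F_2 M in_ker in_ker_submod.

Record kernel := Kernel { kernel_val : M; kernel_valP : kernel_val \in in_ker }.

HB.instance Definition _ := [isSub for kernel_val].
HB.instance Definition _ := [Choice of kernel by <:].
HB.instance Definition _ := [SubChoice_isSubLmodule of kernel by <:].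

Fact ker_act_subproof a (x : kernel) : dm_act M a (val x) \in in_ker.
Proof. by rewrite unfold_in dh_act (eqP (kernel_valP x)) linear0. Qed.

Fact ker_dif_subproof (x : kernel) : dm_dif M (val x) \in in_ker.
Proof. by rewrite unfold_in dh_dif (eqP (kernel_valP x)) linear0. Qed.

Definition ker_act a x : kernel := Kernel (ker_act_subproof a x).
Definition ker_dif_fun x : kernel := Kernel (ker_dif_subproof x).

Fact ker_dif_linear : linear ker_dif_fun.
Proof. by move=> k x y; apply/val_inj; rewrite /= !linearP. Qed.

HB.instance Definition _ :=
  GRing.isLinear.Build 'F_2 kernel kernel *:%R ker_dif_fun ker_dif_linear.

Definition ker_dif : {linear kernel -> kernel} := ker_dif_fun.

Fact ker_act_linr a : linear (ker_act a).
Proof. by move=> k x y; apply/val_inj; rewrite /= !linearP. Qed.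

Fact ker_act_linl x : linear (ker_act^~ x).
Proof. by move=> k a b; apply/val_inj; rewrite /= dm_act_linl. Qed.

Fact ker_act1 x : ker_act (da_one A) x = x.
Proof. by apply/val_inj; rewrite /= dm_act1. Qed.

Fact ker_actA a b x : ker_act (da_mul a b) x = ker_act a (ker_act b x).
Proof. by apply/val_inj; rewrite /= dm_actA. Qed.

Fact ker_difK x : ker_dif (ker_dif x) = 0.
Proof. by apply/val_inj; rewrite /= dm_difK. Qed.

Fact ker_leibniz a x :
  ker_dif (ker_act a x) = ker_act (da_dif a) x + ker_act a (ker_dif x).
Proof. by apply/val_inj; rewrite /= dm_leibniz. Qed.

Variables (I : finType) (P : {set I}) (g : I -> kernel) (spg : spans P g).

Definition ker_dmod : dmod A :=
  DMod ker_act_linr ker_act_linl ker_act1 ker_actA ker_difK ker_leibniz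
    (spans_fingen ker_act_linl ker_act1 spg).

Definition ker_incl : dhom ker_dmod M :=
  @DHom A ker_dmod M (val : kernel -> M) (fun _ _ => erefl) (fun _ => erefl).

End Kernel.

Lemma dm_id_iso X : is_diso (dm_id X).
Proof. by exists (dm_id X); split; apply: dme_idl. Qed.

Lemma quasi_iso_diso X Y (s : dhom X Y) : quasi_iso s -> is_diso (dm_map s).
Proof.
by move=> qs; exists (dm_inv qs); split; [apply: dme_invl|apply: dme_invr].
Qed.

Lemma cone_distinguished M N (f : dhom M N) :
  distinguished (dm_map f) (dm_map (cone_inl f)) (dm_map (cone_proj f)).
Proof.
exists M, N, f, (dm_id M), (dm_id N), (dm_id (cone f)).
split; split; try exact: dm_id_iso;
  by apply: dme_trans (dme_idl _) _; apply/dme_sym/dme_idr.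
Qed.

(** A short exact sequence K -> M -> N and the map x |-> (0, i x) from K to the
    cone of f. *)
Section ShortExact.
Variables (K M N : dmod A) (i : dhom K M) (f : dhom M N).

Definition to_cone_fun (x : K) : cone f := (0, i x).

Fact to_cone_linear : linear to_cone_fun.
Proof. by move=> k x y; congr pair; rewrite /= ?scaler0 ?addr0 ?linearP. Qed.

HB.instance Definition _ :=
  GRing.isLinear.Build 'F_2 K (cone f) *:%R to_cone_fun to_cone_linear.

Hypothesis i_ker : forall x, f (i x) = 0.

Fact to_cone_act a x : to_cone_fun (dm_act K a x) = dm_act (cone f) a (0, i x).
Proof. by congr pair; rewrite /= ?linear0 ?dh_act. Qed.

Fact to_cone_dif x : to_cone_fun (dm_dif K x) = dm_dif (cone f) (0, i x).
Proof. by congr pair; rewrite /= ?i_ker ?linear0 ?addr0 ?dh_dif. Qed.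

Definition to_cone : dhom K (cone f) :=
  @DHom A K (cone f) to_cone_fun to_cone_act to_cone_dif.

Hypothesis i_inj : injective i.
Hypothesis ker_i : forall m, f m = 0 -> exists x, m = i x.
Hypothesis f_surj : forall n, exists m, f m = n.

(** If f m1 = n, subtracting the boundary of (0, m1) removes the component n
    of (n, m); this brings every cycle, and every primitive of a cycle coming
    from K, into the image of K. *)
Lemma to_cone_quasi_iso : quasi_iso to_cone.
Proof.
split=> [x dx0 [[n m] [en em]]|[n m] [en em]].
  have [m1 fm1] := f_surj n.
  have [|w ew] := ker_i (m := m + dm_dif M m1).
    by rewrite linearD dh_dif fm1 addrC -en.
  by exists w; apply: i_inj; rewrite dh_dif -ew linearD dm_difK addr0 -em.
have [m1 fm1] := f_surj n.
have [|x ex] := ker_i (m := m + dm_dif M m1).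
  by rewrite linearD dh_dif fm1 addrC -en.
exists x, (0, m1); split.
  by apply: i_inj; rewrite dh_dif -ex linearD dm_difK addr0 linear0 -em.
congr pair; rewrite /= ?linear0 ?add0r ?fm1 //.
by rewrite -ex -addrA addF2 addr0.
Qed.

Lemma triangulated_extension S : triangulated_sub S -> S K -> S N -> S M.
Proof.
move=> triS SK SN; apply: (ts_tri23 triS (cone_distinguished f)) => //.
exact: (ts_iso triS (quasi_iso_diso to_cone_quasi_iso)).
Qed.

End ShortExact.

End DerivedCategory.

(** * Algebras with a nilpotent radical complementary to idempotents *)

(** E marks the idempotents of the basis; J is spanned by the other elements.
    [mul_E] says that the coordinates on E form a homomorphism to a product of
    fields, so that the coordinate i is the action on a simple module; [dif_E]
    that differentials lie in J; [mul_len] that J is nilpotent. *)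
Section SplitAlgebra.
Variables (T : finType) (c : struct_const T) (E : pred T) (len : T -> nat).
Hypothesis one_E : forall t, sc_one c t = (E t)%:R.
Hypothesis mul_E :
  forall t u v, E v -> sc_mul c t u v = ((t == v) && (u == v))%:R.
Hypothesis dif_E : forall t v, E v -> sc_dif c t v = 0.
Hypothesis mul_len :
  forall t u v, ~~ E t -> sc_mul c t u v != 0 -> (len u < len v)%N.

Let A := dalg_of c.

Definition basis_elt (t : T) : A := [ffun v => (v == t)%:R].

Lemma sum_basis (a : A) :
  a = \sum_t ((a : {ffun T -> ('F_2)^o}) t : 'F_2) *: basis_elt t.
Proof.
apply/ffunP => v; rewrite sum_ffunE (bigD1 v) //= big1 => [|t tv].
  by rewrite !ffunE eqxx addr0 [RHS]mulr1.
by rewrite !ffunE eq_sym (negbTE tv) [LHS]mulr0.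
Qed.

Section Simple.
Variables (i : T) (Ei : E i).

Definition simple_act (a : A) (x : ('F_2)^o) : ('F_2)^o :=
  ((a : {ffun T -> ('F_2)^o}) i : 'F_2) * x.

Definition simple_dif : {linear ('F_2)^o -> ('F_2)^o} := \0.

Fact simple_act_linr a : linear (simple_act a).
Proof. by move=> k x y; rewrite /simple_act mulrDr [a i * _]mulrCA. Qed.

Fact simple_act_linl x : linear (simple_act^~ x).
Proof. by move=> k a b; rewrite /simple_act !ffunE mulrDl -[_ * x]mulrA. Qed.

Fact simple_act1 x : simple_act (da_one A) x = x.
Proof. by rewrite /simple_act !ffunE one_E Ei mul1r. Qed.

Fact simple_actA a b x :
  simple_act (da_mul a b) x = simple_act a (simple_act b x).
Proof.
rewrite /simple_act !ffunE mulrA; congr (_ * _).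
rewrite (bigD1 i) //= [X in _ + X]big1 ?addr0 => [|t ti].
  rewrite (bigD1 i) //= big1 ?addr0 => [|u ui]; rewrite mul_E ?eqxx ?mulr1 //.
  by rewrite (negbTE ui) mulr0.
by rewrite big1 // => u _; rewrite mul_E // (negbTE ti) mulr0.
Qed.

Fact simple_difK x : simple_dif (simple_dif x) = 0.
Proof. by []. Qed.

Fact simple_leibniz a x : simple_dif (simple_act a x) =
  simple_act (da_dif a) x + simple_act a (simple_dif x).
Proof.
rewrite /simple_act !ffunE /= big1 => [|t _]; first by rewrite mul0r mulr0 addr0.
by rewrite dif_E // mulr0.
Qed.

Fact simple_fingen : exists (k : nat) (g : 'I_k -> ('F_2)^o), forall x,
  exists c : 'I_k -> A, x = \sum_(j < k) simple_act (c j) (g j).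
Proof.
exists 1%N, (fun=> 1) => x; exists (fun=> [ffun=> x]).
by rewrite big_ord1 /simple_act ffunE mulr1.
Qed.

Definition simple_module : dmod A :=
  DMod simple_act_linr simple_act_linl simple_act1 simple_actA simple_difK
    simple_leibniz simple_fingen.

End Simple.

Lemma basis_mul t u v :
  (da_mul (basis_elt t) (basis_elt u) : {ffun T -> ('F_2)^o}) v = sc_mul c t u v.
Proof.
rewrite ffunE (bigD1 t) //= [X in _ + X]big1 ?addr0 => [|t' tt'].
  rewrite (bigD1 u) //= big1 ?addr0 => [|u' uu']; rewrite !ffunE ?eqxx ?mul1r //.
  by rewrite (negbTE uu') mul0r.
by rewrite big1 // => u' _; rewrite !ffunE (negbTE tt') !mul0r.
Qed.

Lemma dif_coef_E (a : A) v :
  E v -> (da_dif a : {ffun T -> ('F_2)^o}) v = 0.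
Proof. by move=> Ev; rewrite ffunE big1 // => t _; rewrite dif_E // mulr0. Qed.

Section Module.
Variable M : dmod A.

(** The span of the products t m with t in P; JM when P is the complement of
    E.  By [layer_act] it contains a m whenever a is supported on P. *)
Definition layer (P : pred T) (y : M) :=
  exists h : T -> M, y = \sum_(t | P t) dm_act M (basis_elt t) (h t).

Lemma layer_subspace P : subspace (layer P).
Proof.
split=> [|x y [h ->] [h' ->]].
  by exists (fun=> 0); rewrite big1 // => t _; rewrite linear0.
exists (fun t => h t + h' t); rewrite -big_split.
by apply: eq_bigr => t _; rewrite linearD.
Qed.

Lemma act_basis (a : A) m : dm_act M a m =
  \sum_t dm_act M (basis_elt t) (((a : {ffun T -> ('F_2)^o}) t : 'F_2) *: m).
Proof.
rewrite -[LHS]/(act_on m a) [in LHS](sum_basis a) linear_sum.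
by apply: eq_bigr => t _; rewrite linearZ [RHS]linearZ.
Qed.

Lemma layer_act (P : pred T) (a : A) m :
  (forall v, ~~ P v -> (a : {ffun T -> ('F_2)^o}) v = 0) ->
  layer P (dm_act M a m).
Proof.
move=> aP; exists (fun t => ((a : {ffun T -> ('F_2)^o}) t : 'F_2) *: m).
rewrite act_basis [in RHS]big_mkcond; apply: eq_bigr => t _.
by case: ifPn => // /aP->; rewrite scale0r linear0.
Qed.

Lemma unit_expansion m : m = \sum_(t | E t) dm_act M (basis_elt t) m.
Proof.
rewrite -{1}(dm_act1 (d := M) m) act_basis [RHS]big_mkcond.
apply: eq_bigr => t _; rewrite ffunE one_E.
by case: (E t); rewrite ?scale1r // scale0r linear0.
Qed.

(** d (t m) = (dt) m + t (dm), and dt lies in J. *)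
Lemma layer_dif y : layer (predC E) y -> layer (predC E) (dm_dif M y).
Proof.
case=> h ->; rewrite linear_sum; apply: subspace_sum (layer_subspace _) _ => t Et.
rewrite dm_leibniz; apply: (layer_subspace _).2; apply: layer_act => v.
  by rewrite /= negbK; apply: dif_coef_E.
rewrite /= negbK ffunE => Ev; case: eqP => // vt; move: Et.
by rewrite /= -vt Ev.
Qed.

(** Iterating M = JM writes each vector as a combination of t m with t of
    arbitrarily large length, and the basis is finite. *)
Lemma radical_nilpotent :
  (forall y, layer (predC E) y) -> forall y : M, y = 0.
Proof.
move=> radM y.
have layerM k z : layer (fun t => k <= len t)%N z.
  elim: k z => [|k IHk] z.
    by exists (fun t => if E t then z else 0); rewrite {1}[z]unit_expansion
       big_mkcond; apply: eq_bigr => t _; case: (E t); rewrite ?linear0.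
  have [h ->] := radM z; apply: subspace_sum (layer_subspace _) _ => t Et.
  have [h' ->] := IHk (h t); rewrite linear_sum.
  apply: subspace_sum (layer_subspace _) _ => u ku.
  rewrite /= -dm_actA; apply: layer_act => v; rewrite basis_mul -ltnNge ltnS => vk.
  apply: contraTeq (leq_trans vk ku) => /(mul_len Et); by rewrite -ltnNge.
have [h ->] := layerM (\max_t len t).+1 y; rewrite big1 // => t.
by rewrite ltnNge (leq_bigmax t).
Qed.

(** The subspace JM + dM. *)
Definition radical_or_boundary (y : M) :=
  exists m, layer (predC E) (y - dm_dif M m).

(** If JM + dM = M, then y = dm + j and m = dm' + j' give y = dj' + j, which
    lies in JM since JM is stable under d; so M = JM. *)
Lemma radical_or_boundary_proper :
  (exists y : M, y <> 0) -> exists x, ~ radical_or_boundary x.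
Proof.
case=> y y_neq0; apply: contrapT => noW; apply: y_neq0; move: y.
have allW y : radical_or_boundary y.
  by apply: contrapT => Wy; apply: noW; exists y.
apply: radical_nilpotent => y; have [m ym] := allW y; have [m' mm'] := allW m.
rewrite -[y](subrK (dm_dif M m)); apply: (layer_subspace _).2 => //.
by have := layer_dif mm'; rewrite linearB dm_difK subr0.
Qed.

(** With phi vanishing on JM + dM, the map is f m = phi (i m).  Modulo J the
    product i a is the multiple of i by the coordinate of a at i, which makes f
    linear over the algebra; and i (dm) = d (i m) + (di) m makes f kill
    boundaries. *)
Lemma exists_map_to_simple (I : finType) (P : {set I}) (g : I -> M) :
  spans P g -> (exists y : M, y <> 0) ->
  exists (i : {i | E i}) (f : dhom M (simple_module (valP i))) m, f m = 1.
Proof.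
move=> spg /radical_or_boundary_proper[x xW].
have subW : subspace radical_or_boundary.
  split; first by exists 0; rewrite linear0 subr0; apply: (layer_subspace _).1.
  move=> y z [m ym] [m' zm']; exists (m + m').
  by rewrite linearD opprD addrACA; apply: (layer_subspace _).2.
have radW y : layer (predC E) y -> radical_or_boundary y.
  by exists 0; rewrite linear0 subr0.
have [i Ei ixW] : exists2 i, E i & ~ radical_or_boundary (dm_act M (basis_elt i) x).
  apply: contrapT => noi; apply: xW; rewrite [x]unit_expansion.
  apply: subspace_sum subW _ => i Ei; apply: contrapT => ixW; apply: noi.
  by exists i.
have [phi [phiW phi_x]] := separating_functional spg subW ixW.
exists (exist _ i Ei).
pose f m := phi (dm_act M (basis_elt i) m).
have f_lin : linear f by move=> k u v; rewrite /f !linearP.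
have f_act a m : f (dm_act M a m) = simple_act i a (f m).
  pose ai : 'F_2 := (a : {ffun T -> ('F_2)^o}) i.
  (* r lies in J. *)
  pose r := da_mul (basis_elt i) a - ai *: basis_elt i.
  rewrite /f.
  have -> : dm_act M (basis_elt i) (dm_act M a m) =
            dm_act M r m + ai *: dm_act M (basis_elt i) m.
    rewrite -dm_actA -[in RHS]/(act_on m r) linearB linearZ /=.
    by rewrite subrK.
  rewrite linearD phiW ?add0r ?linearZ //; apply/radW/layer_act => v.
  rewrite /= negbK => Ev; rewrite /r !ffunE; apply/eqP; rewrite subr_eq0; apply/eqP.
  rewrite (bigD1 i) //= [X in _ + X]big1 ?addr0 => [|t ti]; last first.
    by rewrite big1 // => u _; rewrite ffunE (negbTE ti) !mul0r.
  rewrite (bigD1 v) //= big1 ?addr0 => [|u uv].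
    rewrite ffunE eqxx mul1r mul_E // eqxx andbT eq_sym.
    by case: eqP => [->|_]; rewrite ?mulr0 // /GRing.scale /= ?mulr0 ?mulr1.
  by rewrite mul_E // (negbTE uv) andbF mulr0.
have f_dif m : f (dm_dif M m) = 0.
  rewrite /f; have -> : dm_act M (basis_elt i) (dm_dif M m) =
      dm_dif M (dm_act M (basis_elt i) m) + dm_act M (da_dif (basis_elt i)) m.
    by rewrite dm_leibniz addrAC addF2 add0r.
  apply: phiW; apply: subW.2.
    by exists (dm_act M (basis_elt i) m); rewrite subrr; apply: (layer_subspace _).1.
  by apply/radW/layer_act => v; rewrite /= negbK; apply: dif_coef_E.
pose fM := GRing.isLinear.Build 'F_2 M ('F_2)^o *:%R f f_lin.
pose fL : {linear M -> ('F_2)^o} := HB.pack f fM.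
by exists (@DHom A M (simple_module (valP (exist _ i Ei))) fL f_act f_dif), x.
Qed.

End Module.

(** Induction on the number of vectors spanning M: the pivot i0, on which the
    map to a simple module does not vanish, is lost on passing to its kernel. *)
Lemma simples_generate_spanned S (I : finType) (P : {set I}) (M : dmod A)
    (g : I -> M) :
  triangulated_sub S -> (forall i : {i | E i}, S (simple_module (valP i))) ->
  spans P g -> S M.
Proof.
move=> triS SE; elim: {P}#|P| {-2}P (leqnn #|P|) M g => [|n IHn] P leP M g spg.
  apply: (ts_zero triS) => x; have [e ->] := spg x.
  by move: leP; rewrite leqn0 cards_eq0 => /eqP->; rewrite big_set0.
have [Mn0|M0] := pselect (exists y : M, y <> 0); last first.
  by apply: (ts_zero triS) => x; apply: contrapT => x0; apply: M0; exists x.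
have [i [f [m fm]]] := exists_map_to_simple spg Mn0.
have [i0 Pi0 fi0] : exists2 i0, i0 \in P & f (g i0) = 1.
  apply: contrapT => nof; have [e mE] := spg m.
  move: fm; rewrite mE linear_sum big1 => [/eqP|j Pj].
    by rewrite eq_sym oner_eq0.
  rewrite linearZ; have [->|fj] := F2_eq01 (f (g j)); first exact: scaler0.
  by case: nof; exists j.
have hP j : g j - (f (g j) : 'F_2) *: g i0 \in in_ker f.
  by rewrite unfold_in linearB linearZ /= fi0 [_ *: _]mulr1 subrr.
pose h j := Kernel (hP j).
have sph : spans (P :\ i0) h.
  move=> x; have [e xE] := spans_ker spg fi0 (eqP (kernel_valP x)).
  by exists e; apply/val_inj/(etrans xE); rewrite linear_sum.
apply: (triangulated_extension (i := ker_incl sph) (f := f)) => //.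
- by move=> x; apply/eqP; exact: (kernel_valP x).
- exact: val_inj.
- by move=> y /eqP fy; exists (Kernel (fy : y \in in_ker f)).
- by move=> k; exists ((k : 'F_2) *: m); rewrite linearZ fm [LHS]mulr1.
- apply: (IHn (P :\ i0) _ (ker_dmod sph) h sph).
  by move: leP; rewrite (cardsD1 i0) Pi0.
Qed.

Theorem generated_by_simples : Db_finitely_generated A.
Proof.
exists #|{: {i | E i}}|, (fun j => simple_module (valP (enum_val j))).
move=> M S triS SG.
have {}SG (i : {i | E i}) : S (simple_module (valP i)).
  by have := SG (enum_rank i); rewrite enum_rankK.
have [k [g gP]] := dm_fingen M.
pose b (ti : T * 'I_k) := dm_act M (basis_elt ti.1) (g ti.2).
apply: (simples_generate_spanned (P := setT) (g := b)) => // m.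
have [a {1}->] := gP m.
exists (fun ti => (a ti.2 : {ffun T -> ('F_2)^o}) ti.1).
rewrite -(eq_bigl _ _ (fun=> esym (in_setT _))).
rewrite -(pair_bigA _ (fun t j => ((a j : {ffun T -> ('F_2)^o}) t : 'F_2) *: b (t, j))).
rewrite exchange_big /=; apply: eq_bigr => j _; rewrite act_basis.
by apply: eq_bigr => t _; rewrite linearZ.
Qed.

End SplitAlgebra.

(** * Chords *)

Section Chords.
Variable Z : arc_diagram.
Implicit Types a b : pt Z.

(** Only compared between points on the same circle. *)
Definition pos a : nat := tagged a.

Lemma pt_lt_pos a b : pt_lt a b -> (pos a < pos b)%N.
Proof. by case/andP. Qed.

Definition B_idem (t : B_basis Z) : bool := if t is inl _ then true else false.

Definition B_len (t : B_basis Z) : nat :=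
  if t is inr r then (pos (val r).2 - pos (val r).1)%N else 0.

Lemma algB_finitely_generated : Db_finitely_generated (algB Z).
Proof.
apply: (@generated_by_simples _ (B_sc Z) B_idem B_len) => //.
- by case.
- move=> t u [R _|//]; case: t u => [P|r] [Q|s] //=.
    rewrite -[inl P == _]/(P == R) -[inl Q == _]/(Q == R) [R == P]eq_sym.
    by case: (P =P R) => [->|_]; rewrite ?andbF // andbT eq_sym.
  by rewrite andbF.
- case=> [//|r] u [R|d] _ /=; first by case: u => //=; rewrite eqxx.
  have [r12 d12] := (pt_lt_pos (valP r), pt_lt_pos (valP d)).
  case: u => [P|s] /=; first by rewrite subn_gt0.
  have s12 := pt_lt_pos (valP s).
  case: andP => [[/eqP rs /eqP->] _ /=|]; last by rewrite eqxx.
  by rewrite rs in r12; rewrite ltn_sub2l // (ltn_trans r12).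
Qed.

End Chords.

(** * Strand diagrams *)

Section Strands.
Variable Z : arc_diagram.
Implicit Types (a b : pt Z) (p q : strand Z) (s t v : {set strand Z}).

Definition all_flat s : bool := [forall p in s, flat p].

Lemma diagram_slope s p : is_diagram s -> p \in s -> flat p || rising p.
Proof. by case/and4P=> /forall_inP slope _ _ _; apply: slope. Qed.

Lemma diagram_end_inj s p q :
  is_diagram s -> p \in s -> q \in s -> p.2 = q.2 -> p = q.
Proof.
case/and4P=> _ /forall_inP inj _ _ sp sq e.
by apply/eqP; have /forall_inP/(_ q sq) := inj p sp; rewrite e eqxx orbT.
Qed.

Lemma diagram_mate s a :
  is_diagram s -> ((a, a) \in s) = ((mt a, mt a) \in s).
Proof. by case/and4P=> _ _ /forallP/(_ a)/eqP. Qed.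

Lemma rising_not_flat p : rising p -> ~~ flat p.
Proof. by move/pt_lt_pos=> lt; apply: contraTN lt => /eqP->; rewrite ltnn. Qed.

Lemma pt_lt_trans b a c : pt_lt a b -> pt_lt b c -> @pt_lt Z a c.
Proof.
case/andP=> /eqP eab ab /andP[/eqP ebc bc].
by apply/andP; split; [rewrite eab ebc | apply: ltn_trans bc].
Qed.

Lemma diagram_slopeP s p : is_diagram s -> p \in s -> p.1 = p.2 \/ rising p.
Proof. by move=> ds /(diagram_slope ds)/orP[/eqP|]; [left|right]. Qed.

Lemma concatP s t r :
  reflect (exists p q, [/\ p \in s, q \in t, p.2 = q.1 & r = (p.1, q.2)])
          (r \in concat s t).
Proof.
rewrite inE; apply: (iffP exists_inP) => [[p sp /exists_inP[q tq]]|].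
  by case/andP=> /eqP e /eqP->; exists p, q.
case=> p [q [sp tq e ->]]; exists p => //; apply/exists_inP; exists q => //.
by rewrite e !eqxx.
Qed.

Lemma concat_flat s : all_flat s -> concat s s = s.
Proof.
move=> /forall_inP fs; apply/setP=> r; apply/concatP/idP.
  case=> p [q [sp sq e ->]]; rewrite -(eqP (fs q sq)) -e.
  by case: p sp {e}.
by move=> sr; exists r, r; split=> //; [apply/esym/eqP/fs | case: (r)].
Qed.

Lemma composable_refl_flat s : all_flat s -> composable s s.
Proof.
move=> /forall_inP fs; apply/and5P; split.
- by apply/forall_inP=> p /fs fp; apply/implyP=> /rising_not_flat; rewrite fp.
- by apply/forall_inP=> p /fs fp; apply/implyP=> /rising_not_flat; rewrite fp.
- apply/forallP=> a; apply/implyP=> sa; apply/exists_inP.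
  by exists (a, a); rewrite ?eqxx.
- apply/forallP=> a; apply/implyP=> sa; apply/exists_inP.
  by exists (a, a); rewrite ?eqxx.
apply/forall_inP=> p sp; apply/forall_inP=> p' sp'.
apply/forall_inP=> q sq; apply/forall_inP=> q' sq'; apply/implyP=> _.
rewrite /crossing (eqP (fs p sp)) (eqP (fs p' sp')).
apply/negP=> /andP[+ _]; case/orP=> /andP[/pt_lt_pos lt1 /pt_lt_pos lt2];
  by have := ltn_trans lt1 lt2; rewrite ltnn.
Qed.

(** A product is horizontal only if both factors are, since a rising strand of
    either factor is continued to a rising strand of the product.  Horizontal
    composable diagrams are equal: a strand of s at a meets a strand of t at a or
    at its mate, and the strands of t come in matched pairs. *)
Lemma composable_flat s t v :
  is_diagram s -> is_diagram t -> all_flat v ->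
  composable s t && (v == concat s t) = (s == v) && (t == v).
Proof.
move=> ds dt fv; apply/idP/idP; last first.
  case/andP=> /eqP-> /eqP->.
  by rewrite concat_flat // eqxx andbT composable_refl_flat.
case/andP=> /and5P[/forall_inP rs /forall_inP rt /forallP fs /forallP ft _].
move=> /eqP vE.
have flat_concat p q : p \in s -> q \in t -> p.2 = q.1 -> p.1 = q.2.
  move=> sp tq e; apply/eqP/(forall_inP fv (p.1, q.2)); rewrite vE.
  by apply/concatP; exists p, q.
have flat_s p : p \in s -> p = (p.1, p.1).
  move=> sp; have [e|rp] := diagram_slopeP ds sp; first by rewrite {2}e; case: (p).
  have /implyP/(_ rp)/exists_inP[q tq /eqP qp] := rs p sp.
  have e := flat_concat p q sp tq (esym qp); have := pt_lt_pos rp.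
  have [qe|/pt_lt_pos] := diagram_slopeP dt tq; first by rewrite e -qe qp ltnn.
  by rewrite qp -e => /ltn_trans lt /lt; rewrite ltnn.
have flat_t q : q \in t -> q = (q.1, q.1).
  move=> tq; have [e|rq] := diagram_slopeP dt tq; first by rewrite {2}e; case: (q).
  have /implyP/(_ rq)/exists_inP[p sp /eqP pq] := rt q tq.
  have := pt_lt_pos rq; rewrite -(flat_concat p q sp tq pq) -pq.
  by rewrite [in pos p.2](flat_s p sp) ltnn.
have st : s = t.
  apply/setP=> p; apply/idP/idP=> [sp|tp].
    have pE := flat_s p sp; rewrite pE in sp *.
    have /implyP/(_ sp)/exists_inP[q tq qp] := fs p.1.
    have tqq : (q.1, q.1) \in t by rewrite -flat_t.
    by case/orP: qp tqq => /eqP->; rewrite // (diagram_mate p.1 dt).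
  have pE := flat_t p tp; rewrite pE in tp *.
  have /implyP/(_ tp)/exists_inP[q sq qp] := ft p.1.
  have sqq : (q.2, q.2) \in s by move: (sq); rewrite (flat_s q sq).
  by case/orP: qp sqq => /eqP->; rewrite // (diagram_mate p.1 ds).
have fs' : all_flat s.
  by apply/forall_inP=> p sp; rewrite /flat (flat_s p sp) eqxx.
by rewrite vE -st concat_flat // eqxx.
Qed.

(** Of the two strands of the resolution, the one from p.1 to q.2 starts
    strictly below q.1, and q does not descend. *)
Lemma resolve_not_flat s p q :
  is_diagram s -> resolvable s p q -> ~~ all_flat (resolve s p q).
Proof.
move=> ds /and5P[sp sq p1q1 q2p2 _]; apply/forall_inPn.
exists (p.1, q.2); first by rewrite !inE eqxx orbT.
apply: rising_not_flat; rewrite /rising /=.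
by have [<-//|/(pt_lt_trans p1q1)] := diagram_slopeP ds sq.
Qed.

(** For a strand diagram this is the total length of the strands, as at most
    one strand ends at each b.  With maxima, comparing the lengths of two
    diagrams needs only one well-chosen strand ending at each b. *)
Definition diagram_len s : nat :=
  \sum_b \max_(a | (a, b) \in s) (pos b - pos a).

(** Each rising strand of t is prolonged downwards by a strand of s, so no
    length is lost; a rising strand of s makes the prolongation strict at the
    end point of the strand of t that continues it. *)
Lemma composable_len s t :
  is_diagram s -> is_diagram t -> composable s t -> ~~ all_flat s ->
  (diagram_len t < diagram_len (concat s t))%N.
Proof.
move=> ds dt /and5P[/forall_inP rs /forall_inP rt _ _ _].
case/forall_inPn=> p sp nfp.
have rp : rising p by have := diagram_slope ds sp; rewrite (negbTE nfp).
have /implyP/(_ rp)/exists_inP[q tq /eqP qp] := rs p sp.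
have leq_pos (r : strand Z) u : is_diagram u -> r \in u -> (pos r.1 <= pos r.2)%N.
  by move=> du ur; have [->//|/pt_lt_pos/ltnW] := diagram_slopeP du ur.
rewrite /diagram_len (bigD1 q.2) //= [X in (_ < X)%N](bigD1 q.2) //= -addSn.
apply: leq_add.
  have st_pq : (p.1, q.2) \in concat s t by apply/concatP; exists p, q.
  apply: leq_trans (leq_bigmax_cond (P := fun a => (a, q.2) \in _) _ st_pq).
  apply: (@leq_ltn_trans (pos q.2 - pos q.1)).
    apply/bigmax_leqP=> a ta.
    by have -> : q = (a, q.2) by apply: diagram_end_inj dt tq ta _.
  have rpos := pt_lt_pos rp; rewrite -qp in rpos.
  by rewrite ltn_sub2l // (leq_trans rpos) // (leq_pos q t).
apply: leq_sum => b _; apply/bigmax_leqP=> a tab.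
have [/= ->|rab] := diagram_slopeP dt tab; first by rewrite subnn.
have /implyP/(_ rab)/exists_inP[p' sp' /eqP/= p'a] := rt (a, b) tab.
have st_p'b : (p'.1, b) \in concat s t by apply/concatP; exists p', (a, b).
apply: leq_trans (leq_bigmax_cond (P := fun a => (a, b) \in _) _ st_p'b).
by rewrite leq_sub2l // -p'a (leq_pos p' s).
Qed.

Lemma algC_finitely_generated : Db_finitely_generated (algC Z).
Proof.
apply: (@generated_by_simples _ _ (fun d => all_flat (strands (val d)))
  (fun d => diagram_len (strands (val d)))) => //.
- move=> t u v fv; rewrite /= composable_flat //; exact: valP.
- move=> t v fv; apply: big1 => -[p q] /= rpq; case: eqP => // vE.
  by move: fv; rewrite vE (negbTE (resolve_not_flat _ rpq)) //; apply: valP.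
- move=> t u v ft /=; case: andP => [[tu /eqP->] _|]; last by rewrite eqxx.
  by apply: composable_len => //; apply: valP.
Qed.

End Strands.

Theorem theorem3 (Z : arc_diagram) :
  Db_finitely_generated (algB Z) /\ Db_finitely_generated (algC Z).
Proof. by split; [apply: algB_finitely_generated|apply: algC_finitely_generated]. Qed.
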